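(* Let $R$ be a PID and $I$ a nonzero proper ideal of $R$. (a) Suppose $2$ is a nonzero nonunit of $R$. Then $I$ is an sdf-absorbing ideal of $R$ if and only if either $I$ is a prime (maximal) ideal of $R$, i.e., $I = aR$ for some prime $a \in R$, or $I = aR$, where $a = a_1 \cdots a_n a_{n+1}$ for some integer $n \geq 1$ and (pairwise) nonassociate primes $a_1, \ldots, a_{n+1} \in R$ such that $a_i \mid 2$ in $R$ for every $1 \leq i \leq n$. In particular, if $2 \in R$ is prime, then $I$ is an sdf-absorbing ideal of $R$ if and only if $I$ is a prime (maximal) ideal of $R$ or $I = 2pR$ for some prime $p \in R$ not associate to $2$. (b) If $2$ is a unit of $R$, then $I$ is an sdf-absorbing ideal of $R$ if and only if $I$ is a prime (maximal) ideal of $R$, i.e., $I = aR$ for some prime $a \in R$. (c) If $\operatorname{char}(R) = 2$, then $I$ is an sdf-absorbing ideal of $R$ if and only if $I$ is a radical ideal of $R$, i.e., $I = a_1 \cdots a_n R$ for some $n \geq 1$ and (pairwise) nonassociate primes $a_1, \ldots, a_n \in R$.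
   Context: All rings are commutative with identity $1 \neq 0$. A proper ideal $I$ of a commutative ring $R$ is a square-difference factor absorbing ideal (sdf-absorbing ideal) of $R$ if whenever $a, b \in R$ are both nonzero and $a^2 - b^2 \in I$, then $a + b \in I$ or $a - b \in I$. *)

(* Defs.v *)
From HB Require Import structures.
From mathcomp Require Import all_boot all_order all_algebra.
From mathcomp Require Import boolp classical_sets.

Set Implicit Arguments.
Unset Strict Implicit.
Unset Printing Implicit Defensive.

Import GRing.Theory.
Local Open Scope ring_scope.
Local Open Scope classical_set_scope.

(* Ideals are Prop-valued subsets [I : set R]; [[in I]] is the classical
   boolean membership predicate on which the predicates of [ring_quotient]
   (idealr_closed, prime_idealr_closed) are stated. *)

(* [idealr_closed] includes [1 \notin I], so this is a proper ideal. *)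
Definition proper_ideal_set (R : comNzRingType) (I : set R) : Prop :=
  idealr_closed [in I].

(* A possibly improper ideal: a submodule of R as a module over itself. *)
Definition ideal_set (R : comNzRingType) (I : set R) : Prop :=
  GRing.submod_closed ([in I] : {pred R^o}).

Definition principal_ideal (R : comNzRingType) (a : R) : set R :=
  [set a * x | x in [set: R]].

Definition is_pid (R : idomainType) : Prop :=
  forall J : set R, ideal_set J -> exists a : R, J = principal_ideal a.

Definition prime_ideal_set (R : comNzRingType) (I : set R) : Prop :=
  proper_ideal_set I /\ prime_idealr_closed [in I].

Definition maximal_ideal_set (R : comNzRingType) (I : set R) : Prop :=
  proper_ideal_set I /\
  forall J : set R, proper_ideal_set J -> I `<=` J -> J = I.

Definition radical (R : comNzRingType) (I : set R) : set R :=
  [set x | exists2 n : nat, (0 < n)%N & I (x ^+ n)].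

Definition radical_ideal_set (R : comNzRingType) (I : set R) : Prop :=
  ideal_set I /\ radical I = I.

Definition sdf_absorbing (R : comNzRingType) (I : set R) : Prop :=
  proper_ideal_set I /\
  forall a b : R, a != 0 -> b != 0 ->
    I (a ^+ 2 - b ^+ 2) -> I (a + b) \/ I (a - b).

Definition divides (R : comNzRingType) (a b : R) : Prop :=
  exists c : R, b = a * c.

Definition associates (R : comUnitRingType) (a b : R) : Prop :=
  exists2 u : R, u \is a GRing.unit & b = u * a.

Definition prime_element (R : comUnitRingType) (p : R) : Prop :=
  [/\ p != 0, p \isn't a GRing.unit &
      forall x y : R, divides p (x * y) -> divides p x \/ divides p y].

Definition nonassociate_primes (R : comUnitRingType) (n : nat)
    (a : 'I_n -> R) : Prop :=
  (forall i, prime_element (a i)) /\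
  (forall i j, i != j -> ~ associates (a i) (a j)).

(* Main.v *)
Require Import Defs.
From HB Require Import structures.
From mathcomp Require Import all_boot all_order all_algebra.
From mathcomp Require Import boolp classical_sets.
From mathcomp Require Import ring.

(** Write the ideal as [aR] with [a] neither zero nor a unit.  All three
    parts are readings of one classification ([sdf_absorbing_principal]): [aR]
    is sdf-absorbing exactly when [a] is, up to a unit, a product of
    nonassociate primes of which all but possibly one divide [2].

    Suppose [aR] is sdf-absorbing.  If [a] divides [x^2], then it divides
    [x^2 - a^2], hence [x + a] or [x - a], hence [x]; so [a] is squarefree.
    If [a = pm] with [p] prime, then [p] and [m] are comaximal and there is [v]
    with [v = 1] modulo [p] and [v = -1] modulo [m].  Now [a] divides
    [1 - v^2], so it divides [1 + v], which is [2] modulo [p], or [1 - v],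
    which is [2] modulo [m]: thus [p] or [m] divides [2]
    ([sdf_absorbing_factor]).  Taking for [p] a prime divisor of [a] that does
    not divide [2], if there is one, leaves a cofactor [m] all of whose primes
    divide [2].

    Conversely, suppose that [a] is such a product and divides
    [(u - v)(u + v)].  Modulo a prime dividing [2] the two factors are equal,
    so every such prime divides both of them; the one remaining prime divides
    one of them, and then so does [a] ([sdf_absorbing_prod]).

    When [2] is a unit no prime divides it, so the family is a single prime.
    When [2 = 0] every prime divides it, so the families are arbitrary, which
    is the description of radical ideals ([radical_principal]).  When [2] is
    prime a nonassociate family has at most one member dividing [2].

    Factorization into primes comes from well-founded induction on proper
    divisors ([proper_divisor_ind]), which expresses the ascending chain
    condition on principal ideals. *)

Set Implicit Arguments.
Unset Strict Implicit.
Unset Printing Implicit Defensive.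

Local Open Scope ring_scope.
Local Open Scope classical_set_scope.

Import GRing.Theory.

(** * Divisibility in an integral domain *)

Section Divisibility.

Variable R : idomainType.
Implicit Types a b c d p q x y : R.

Lemma divides_refl a : divides a a.
Proof. by exists 1; rewrite mulr1. Qed.

Lemma divides_trans b a c : divides a b -> divides b c -> divides a c.
Proof. by move=> [x ->] [y ->]; exists (x * y); rewrite mulrA. Qed.

Lemma divides0 a : divides a 0.
Proof. by exists 0; rewrite mulr0. Qed.

Lemma divides_mulr a b c : divides a b -> divides a (b * c).
Proof. by move=> [x ->]; exists (x * c); rewrite mulrA. Qed.

Lemma divides_mull a b c : divides a b -> divides a (c * b).
Proof. by rewrite mulrC; exact: divides_mulr. Qed.

Lemma dividesD a b c : divides a b -> divides a c -> divides a (b + c).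
Proof. by move=> [x ->] [y ->]; exists (x + y); rewrite mulrDr. Qed.

Lemma dividesN a b : divides a b -> divides a (- b).
Proof. by move=> [x ->]; exists (- x); rewrite mulrN. Qed.

Lemma dividesB a b c : divides a b -> divides a c -> divides a (b - c).
Proof. by move=> ab ac; apply: dividesD => //; exact: dividesN. Qed.

Lemma divides_neq0 a b : divides a b -> b != 0 -> a != 0.
Proof. by move=> [x ->]; rewrite mulf_eq0 negb_or => /andP[]. Qed.

Lemma divides_mul2l c : c != 0 ->
  forall a b, divides (c * a) (c * b) <-> divides a b.
Proof.
move=> c0 a b; split=> [[x]|[x ->]]; last by exists x; rewrite mulrA.
by rewrite -mulrA => /(mulfI c0) ->; exists x.
Qed.

Lemma divides1 a : divides a 1 <-> a \is a GRing.unit.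
Proof.
split=> [[x ax]|ua]; last by exists a^-1; rewrite divrr.
by apply/unitrPr; exists x.
Qed.

Lemma divides_unit a b : divides a b -> b \is a GRing.unit ->
  a \is a GRing.unit.
Proof.
by move=> ab /divides1 b1; apply/divides1; exact: divides_trans b1.
Qed.

Lemma prod_mem_divides n (a : 'I_n -> R) i : divides (a i) (\prod_(j < n) a j).
Proof. by rewrite (bigD1 i) //=; apply/divides_mulr/divides_refl. Qed.

Lemma associates_divides a b : associates a b <-> divides a b /\ divides b a.
Proof.
split=> [[u uu ->]|[[x bE] [y aE]]].
  by split; [exists u; rewrite mulrC | exists u^-1; rewrite mulrAC divrr ?mul1r].
have [a0|a0] := eqVneq a 0.
  by exists 1; rewrite ?unitr1 // bE a0 mul0r mulr0.
exists x; last by rewrite bE mulrC.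
apply/divides1; exists y; apply: (mulfI a0).
by rewrite mulrA -bE -aE mulr1.
Qed.

Lemma principal_idealP a x : principal_ideal a x <-> divides a x.
Proof. by split=> [[y _ <-]|[y ->]]; exists y. Qed.

Lemma principal_ideal_sub a b :
  principal_ideal a `<=` principal_ideal b <-> divides b a.
Proof.
split=> [sub|ba x /principal_idealP ax].
  exact/principal_idealP/sub/principal_idealP/divides_refl.
by apply/principal_idealP; exact: divides_trans ax.
Qed.

Lemma principal_ideal_eq a b :
  principal_ideal a = principal_ideal b <-> associates a b.
Proof.
split=> [ab|/associates_divides[ab ba]].
  by apply/associates_divides; split; apply/principal_ideal_sub; rewrite ab.
by rewrite eqEsubset; split; apply/principal_ideal_sub.
Qed.

Lemma ideal_set_principal a : ideal_set (principal_ideal a).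
Proof.
split; first by rewrite in_setE; apply/principal_idealP/divides0.
move=> c x y; rewrite !in_setE => /principal_idealP ax /principal_idealP ay.
by apply/principal_idealP; apply: dividesD => //; exact: divides_mull.
Qed.

Lemma proper_principal a :
  proper_ideal_set (principal_ideal a) <-> a \isn't a GRing.unit.
Proof.
split=> [[_ + _]|ua].
  by apply: contraNN => /divides1/principal_idealP; rewrite in_setE.
have [I0 Ilin] := ideal_set_principal a; split=> //.
apply: contraNN ua; rewrite in_setE => /principal_idealP.
by move/divides1.
Qed.

Lemma proper_ideal_is_ideal (I : set R) : proper_ideal_set I -> ideal_set I.
Proof. by case. Qed.

Lemma prime_divides_prime p q :
  prime_element p -> prime_element q -> divides p q -> divides q p.
Proof.
move=> [p0 pu _] [q0 _ qP] [x qE].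
have [//|[y xE]] : divides q p \/ divides q x.
  by apply: qP; rewrite -qE; exact: divides_refl.
case/negP: pu; apply/divides1; exists y.
by apply: (mulfI q0); rewrite mulr1 {1}qE xE; ring.
Qed.

Lemma prime_principal a : a != 0 ->
  prime_ideal_set (principal_ideal a) <-> prime_element a.
Proof.
move=> a0; split=> [[/proper_principal ua aP]|[_ ua aP]]; split=> //.
- move=> x y /principal_idealP; rewrite -in_setE => /aP/orP.
  by rewrite !in_setE => -[] /principal_idealP; [left|right].
- exact/proper_principal.
- move=> x y; rewrite in_setE => /principal_idealP/aP xy; apply/orP.
  by rewrite !in_setE; case: xy => ?; [left|right]; exact/principal_idealP.
Qed.

End Divisibility.

(** * Products of nonassociate primes *)

Section PrimeFamilies.

Variable R : idomainType.
Implicit Types a b c d p q x y : R.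

Lemma nonassociate_primes_divides n (a : 'I_n -> R) i j :
  nonassociate_primes a -> i != j -> ~ divides (a i) (a j).
Proof.
move=> [pa na] ij dij; apply: (na _ _ ij); apply/associates_divides.
by split=> //; exact: prime_divides_prime.
Qed.

(** Divide [x] by the first prime: the others still divide the quotient, since
    none of them divides the first. *)
Lemma nonassociate_primes_prod_divides n (a : 'I_n -> R) x :
  nonassociate_primes a -> (forall i, divides (a i) x) ->
  divides (\prod_(i < n) a i) x.
Proof.
elim: n a x => [|n IHn] a x na ax.
  by rewrite big_ord0; exists x; rewrite mul1r.
have [y xE] := ax ord0; rewrite big_ord_recl xE.
apply/divides_mul2l; first by case: (na.1 ord0).
apply: IHn => [|i].
  split=> [i|i j ij]; first exact: na.1.
  by apply: na.2; rewrite (inj_eq lift_inj).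
have [_ _ aiP] := na.1 (lift ord0 i).
have /aiP[|//] : divides (a (lift ord0 i)) (a ord0 * y) by rewrite -xE.
by move=> /nonassociate_primes_divides; case=> //; rewrite eq_sym neq_lift.
Qed.

(** The position [k] is left free because the classification reserves the last
    index for the one prime that need not divide [2]. *)
Definition insert_prime n (k : 'I_n.+1) p (a : 'I_n -> R) : 'I_n.+1 -> R :=
  fun i => oapp a p (unlift k i).

Lemma insert_prime_eq n (k : 'I_n.+1) p (a : 'I_n -> R) :
  insert_prime k p a k = p.
Proof. by rewrite /insert_prime unlift_none. Qed.

Lemma insert_prime_lift n (k : 'I_n.+1) p (a : 'I_n -> R) j :
  insert_prime k p a (lift k j) = a j.
Proof. by rewrite /insert_prime liftK. Qed.

Lemma prod_insert_prime n (k : 'I_n.+1) p (a : 'I_n -> R) :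
  \prod_(i < n.+1) insert_prime k p a i = p * \prod_(i < n) a i.
Proof.
rewrite (bigD1_ord k) //= insert_prime_eq; congr (_ * _).
by apply: eq_bigr => i _; rewrite insert_prime_lift.
Qed.

Lemma nonassociate_primes_insert n (k : 'I_n.+1) p (a : 'I_n -> R) :
  prime_element p -> ~ divides p (\prod_(i < n) a i) ->
  nonassociate_primes a -> nonassociate_primes (insert_prime k p a).
Proof.
move=> pp npa [pa na].
have npai i : ~ divides p (a i).
  by move=> /divides_trans pai; exact/npa/pai/prod_mem_divides.
split=> [i|i j].
  by case: (unliftP k i) => [i' ->|->];
    rewrite ?insert_prime_lift ?insert_prime_eq.
case: (unliftP k i) => [i' ->|->]; case: (unliftP k j) => [j' ->|->];
  rewrite ?insert_prime_lift ?insert_prime_eq ?eqxx //.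
- by rewrite (inj_eq lift_inj); exact: na.
- by move=> _ /associates_divides[_ /npai].
- by move=> _ /associates_divides[/npai].
Qed.

End PrimeFamilies.

(** * Radical elements *)

Section RadicalElements.

Variable R : idomainType.
Implicit Types a b c d p q x y m : R.

(** Squarefreeness, phrased by squares alone because a single difference of
    squares tests it. *)
Definition radical_element a := forall x, divides a (x ^+ 2) -> divides a x.

(** Enlarge the exponent to a power of [2] and take square roots repeatedly. *)
Lemma radical_element_expn a n x :
  radical_element a -> divides a (x ^+ n) -> divides a x.
Proof.
move=> ra axn.
have {axn}: divides a (x ^+ (2 ^ n)).
  by rewrite -(subnK (ltnW (ltn_expl n (leqnn 2)))) exprD; exact: divides_mull.
elim: n x => // n IHn x.
by rewrite expnSr exprM => /ra/IHn.
Qed.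

Lemma radical_ideal_setP a :
  radical_ideal_set (principal_ideal a) <-> radical_element a.
Proof.
split=> [[_ radI] x ax|ra].
  by apply/principal_idealP; rewrite -radI; exists 2%N => //; exact/principal_idealP.
split; first exact: ideal_set_principal.
rewrite eqEsubset; split=> x.
  by move=> [n _ /principal_idealP axn]; apply/principal_idealP;
    exact: radical_element_expn axn.
by exists 1%N; rewrite ?expr1.
Qed.

Lemma radical_element_prod n (a : 'I_n -> R) :
  nonassociate_primes a -> radical_element (\prod_(i < n) a i).
Proof.
move=> na x ax; apply: nonassociate_primes_prod_divides => // i.
have [_ _ aiP] := na.1 i.
suff /aiP[] : divides (a i) (x * x) by [].
by rewrite -expr2; apply: divides_trans ax; exact: prod_mem_divides.
Qed.

Lemma radical_element_cofactor p m :
  p != 0 -> radical_element (p * m) -> radical_element m.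
Proof.
move=> p0 rpm x mx; apply/(divides_mul2l p0)/rpm.
by rewrite exprMn expr2 -mulrA; apply/divides_mul2l => //; exact: divides_mull.
Qed.

(** If [m = pc], then [pm = p^2 c] divides [(pc)^2], hence [pc], which forces
    [p] to be a unit. *)
Lemma radical_element_coprime p m : p * m != 0 -> radical_element (p * m) ->
  divides p m -> p \is a GRing.unit.
Proof.
move=> pm0 rpm [c mE]; have pc0 : p * c != 0.
  by move: pm0; rewrite mE mulf_eq0 negb_or => /andP[].
apply/divides1; apply/(divides_mul2l pc0).
have /rpm : divides (p * m) ((p * c) ^+ 2).
  by exists c; rewrite mE; ring.
by rewrite mE mulr1 [p * (p * c)]mulrC.
Qed.

End RadicalElements.

(** * Prime factorization in a principal ideal domain *)

Section PID.

Variable R : idomainType.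
Hypothesis R_pid : is_pid R.
Implicit Types a b c d p q x y m : R.

Lemma ideal_set_sum a b :
  ideal_set [set x | exists r s, x = a * r + b * s].
Proof.
split; first by rewrite in_setE; exists 0, 0; rewrite !mulr0 addr0.
move=> c x y; rewrite !in_setE => -[r [s ->]] [t [u ->]].
by exists (c * r + t), (c * s + u); rewrite /GRing.scale /=; ring.
Qed.

Lemma bezout a b : exists d r s,
  [/\ divides d a, divides d b & d = a * r + b * s].
Proof.
have [d dE] := R_pid (ideal_set_sum a b).
have [r [s drs]] : [set x | exists r s, x = a * r + b * s] d.
  by rewrite dE; exact/principal_idealP/divides_refl.
exists d, r, s; split=> //; apply/principal_idealP; rewrite -dE.
  by exists 1, 0; rewrite mulr1 mulr0 addr0.
by exists 0, 1; rewrite mulr1 mulr0 add0r.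
Qed.

Lemma prime_bezout p m : prime_element p -> ~ divides p m ->
  exists r s, p * r + m * s = 1.
Proof.
move=> [p0 pu pP] npm; have [d [r [s [[c pE] dm dE]]]] := bezout p m.
have : divides p (d * c) by rewrite -pE; exact: divides_refl.
case/pP => [pd|[e cE]]; first by case: npm; exact: divides_trans dm.
have /divides1/unitrPr[f df1] : divides d 1.
  by exists e; apply: (mulfI p0); rewrite mulr1 {1}pE cE; ring.
by exists (r * f), (s * f); rewrite !mulrA -mulrDl -dE.
Qed.

Lemma ideal_set_chain (u : nat -> R) :
  (forall n, divides (u n.+1) (u n)) ->
  ideal_set [set x | exists n, divides (u n) x].
Proof.
move=> uS; have u_le (m n : nat) : (m <= n)%N -> divides (u n) (u m).
  move=> /subnK <-; elim: (n - m)%N => [|k IHk]; first exact: divides_refl.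
  by rewrite addSn; exact: divides_trans (uS _) IHk.
split; first by rewrite in_setE; exists 0%N; exact: divides0.
move=> c x y; rewrite !in_setE => -[m mx] [n ny]; exists (maxn m n).
apply: dividesD; last exact: divides_trans (u_le _ _ (leq_maxr m n)) ny.
by apply: divides_mull; exact: divides_trans (u_le _ _ (leq_maxl m n)) mx.
Qed.

(** A counterexample always has a proper divisor that is again a counterexample.
    Iterating a choice of such a divisor gives a strictly ascending chain of
    principal ideals; a generator of their union lies in one of them, where the
    chain would have to stop. *)
Lemma proper_divisor_ind (P : R -> Prop) :
  (forall a, (forall b, divides b a -> ~ divides a b -> P b) -> P a) ->
  forall a, P a.
Proof.
move=> Pind a; apply: contrapT => nPa.
have step b : exists c, ~ P b -> [/\ ~ P c, divides c b & ~ divides b c].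
  have [Pb|nPb] := pselect (P b); first by exists b.
  apply: contrapT => /forallNP nc; apply: nPb; apply: Pind => c cb nbc.
  by apply: contrapT => nPc; apply: (nc c).
have [f fP] := choice step; pose u n := iter n f a.
have nPu n : ~ P (u n) by elim: n => //= n /fP[].
have [|d dE] := R_pid (J := [set x | exists n, divides (u n) x]).
  by apply: ideal_set_chain => n; have [] := fP _ (nPu n).
have [n und] : [set x | exists n, divides (u n) x] d.
  by rewrite dE; exact/principal_idealP/divides_refl.
have [_ _] := fP _ (nPu n); apply; apply: (divides_trans und).
by apply/principal_idealP; rewrite -dE; exists n.+1; exact: divides_refl.
Qed.

(** If [a] is not prime, it divides some [xy] but neither [x] nor [y].  Then
    [d = gcd(a, x)] is a proper divisor of [a] because [a] does not divide [x],
    and not a unit because [a] does not divide [y]; induction applies to [d]. *)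
Lemma prime_divisor_exists a : a != 0 -> a \isn't a GRing.unit ->
  exists2 p, prime_element p & divides p a.
Proof.
elim/proper_divisor_ind: a => a IHa a0 ua.
have [pa|npa] := pselect (prime_element a).
  by exists a => //; exact: divides_refl.
have [x [y [axy nax nay]]] : exists x y,
    [/\ divides a (x * y), ~ divides a x & ~ divides a y].
  apply: contrapT => nxy; apply: npa; split=> // x y axy.
  have [|nax] := pselect (divides a x); first by left.
  have [|nay] := pselect (divides a y); first by right.
  by case: nxy; exists x, y.
have [d [r [s [da dx dE]]]] := bezout a x.
have [|||p pp pd] := IHa d da.
- by move=> ad; apply: nax; exact: divides_trans dx.
- exact: divides_neq0 da a0.
- apply/negP => /divides1[e de1]; apply: nay.
  (* Multiply the relation [1 = (ar + xs)e] by [y]. *)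
  have -> : y = a * (r * e * y) + x * y * (s * e).
    by rewrite -[LHS]mul1r de1 dE; ring.
  apply: dividesD; first by exists (r * e * y).
  exact: divides_mulr.
- by exists p => //; exact: divides_trans da.
Qed.

(** Splitting off a prime [p] from [a = pm] keeps [m] squarefree, and [p] does
    not divide [m], so [p] is nonassociate to all the primes of [m]. *)
Lemma radical_factorization a : a != 0 -> radical_element a ->
  exists n (f : 'I_n -> R),
    nonassociate_primes f /\ associates (\prod_(i < n) f i) a.
Proof.
elim/proper_divisor_ind: a => a IHa a0 ra.
have [ua|ua] := boolP (a \is a GRing.unit).
  exists 0%N, (fun=> 0); split; first by split=> [[]|[]].
  by rewrite big_ord0; exists a; rewrite ?mulr1.
have [p pp [m aE]] := prime_divisor_exists a0 ua; have [p0 pu _] := pp.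
have npm : ~ divides p m.
  by move=> pm; case/negP: pu; apply: radical_element_coprime pm; rewrite -aE.
have [||||n [f [nf fm]]] := IHa m.
- by rewrite aE; exact/divides_mull/divides_refl.
- by rewrite aE => pmm; apply: npm; apply: divides_trans pmm;
    exact/divides_mulr/divides_refl.
- by move: a0; rewrite aE mulf_eq0 negb_or => /andP[].
- by move: ra; rewrite aE; exact: radical_element_cofactor.
exists n.+1, (insert_prime ord0 p f); split.
  apply: nonassociate_primes_insert => // /divides_trans pf; apply: npm.
  by have /associates_divides[/pf] := fm.
by rewrite prod_insert_prime aE; have [u uu ->] := fm; exists u => //; ring.
Qed.

Lemma proper_nonzero_principal (I : set R) : proper_ideal_set I ->
  I <> [set 0] ->
  exists a, [/\ I = principal_ideal a, a != 0 & a \isn't a GRing.unit].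
Proof.
move=> Ip I0; have [a IE] := R_pid (proper_ideal_is_ideal Ip).
exists a; split=> //; last by apply/proper_principal; rewrite -IE.
apply/eqP => a0; apply: I0; rewrite IE a0 eqEsubset; split=> x.
  by move=> [y _ <-]; rewrite mul0r.
by move=> ->; exists 0; rewrite ?mulr0.
Qed.

(** A maximal [aR] equals [pR] for any prime divisor [p] of [a]. *)
Lemma maximal_principal a : a != 0 -> a \isn't a GRing.unit ->
  maximal_ideal_set (principal_ideal a) <-> prime_element a.
Proof.
move=> a0 ua; split=> [[_ amax]|[_ _ aP]].
  have [p pp pa] := prime_divisor_exists a0 ua; have [p0 pu _] := pp.
  apply/(prime_principal a0); rewrite -(amax (principal_ideal p)).
  - exact/prime_principal.
  - exact/proper_principal.
  - exact/principal_ideal_sub.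
split; first exact/proper_principal.
move=> J Jp; have [d JE] := R_pid (proper_ideal_is_ideal Jp).
move: Jp; rewrite {}JE => /proper_principal ud /principal_ideal_sub[c aE].
apply/principal_ideal_eq/associates_divides.
have : divides a (d * c) by rewrite -aE; exact: divides_refl.
case/aP => [ad|[e cE]]; first by split=> //; exists c.
case/negP: ud; apply/divides1; exists e.
by apply: (mulfI a0); rewrite mulr1 {1}aE cE; ring.
Qed.

End PID.

(** * Square-difference factor absorbing ideals *)

Section SdfAbsorbing.

Variable R : idomainType.
Hypothesis R_pid : is_pid R.
Implicit Types a b p x y m : R.

(** The generator [a] itself serves as the second nonzero element in the
    difference of squares. *)
Lemma sdf_absorbing_radical a : a != 0 ->
  sdf_absorbing (principal_ideal a) -> radical_element a.
Proof.
move=> a0 [_ sdfa] x ax; have [->|x0] := eqVneq x 0; first exact: divides0.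
have aa := divides_refl a.
have /(sdfa _ _ x0 a0) : principal_ideal a (x ^+ 2 - a ^+ 2).
  by apply/principal_idealP/dividesB => //; exact: divides_mulr.
move=> [|] /principal_idealP axa.
  by rewrite -(addrK a x); exact: dividesB.
by rewrite -(subrK a x); exact: dividesD.
Qed.

(** By the Chinese remainder theorem [1] has the square root [v] modulo [pm]
    that is [1] modulo [p] and [-1] modulo [m]; the absorbing property says
    that [v] is [1] or [-1] modulo [pm], so that [1 = -1] modulo [m] or [p]. *)
Lemma sdf_absorbing_factor p m : p * m != 0 -> prime_element p ->
  sdf_absorbing (principal_ideal (p * m)) -> divides p 2%:R \/ divides m 2%:R.
Proof.
move=> pm0 pp sdfpm; have [p0 pu _] := pp.
have npm : ~ divides p m.
  move=> pm; case/negP: pu; apply: radical_element_coprime pm => //.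
  exact: sdf_absorbing_radical.
have [r [s prms]] := prime_bezout R_pid pp npm.
have [/proper_principal upm sdf_pm] := sdfpm.
pose v := 1 - 2%:R * (p * r).
have vE : v = 2%:R * (m * s) - 1 by rewrite -(addKr (p * r) (m * s)) prms /v; ring.
(* [1 - v] is [2pr] and [1 + v] is [2ms], whence the cofactor [4rs]. *)
have dv : principal_ideal (p * m) (1 ^+ 2 - v ^+ 2).
  apply/principal_idealP; exists (4%:R * r * s).
  by rewrite subr_sqr [in 1 + v]vE /v; ring.
have v0 : v != 0.
  apply: contraNneq upm => v0; move: dv => /principal_idealP.
  by rewrite v0 expr0n subr0 expr1n => /divides1.
have [/principal_idealP d|/principal_idealP d] :=
    sdf_pm _ _ (oner_neq0 R) v0 dv.
  left; have -> : 2%:R = (1 + v) + p * (2%:R * r) by rewrite /v; ring.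
  apply: dividesD; last exact/divides_mulr/divides_refl.
  by apply: divides_trans d; exact/divides_mulr/divides_refl.
right; have -> : 2%:R = (1 - v) + m * (2%:R * s) by rewrite vE; ring.
apply: dividesD; last exact/divides_mulr/divides_refl.
by apply: divides_trans d; exact/divides_mull/divides_refl.
Qed.

(** Since [u + v] and [u - v] differ by [2v], a prime dividing [2] and one of
    them divides both, so the last prime alone decides which one absorbs. *)
Lemma sdf_absorbing_prod n (f : 'I_n.+1 -> R) : nonassociate_primes f ->
  (forall i : 'I_n.+1, (i < n)%N -> divides (f i) 2%:R) ->
  sdf_absorbing (principal_ideal (\prod_(i < n.+1) f i)).
Proof.
move=> nf f2; split=> [|u v _ _ /principal_idealP].
  apply/proper_principal; have [_ + _] := nf.1 ord_max.
  by apply: contraNN; apply: divides_unit; exact: prod_mem_divides.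
rewrite subr_sqr => fuv.
have fi i : divides (f i) (u - v) \/ divides (f i) (u + v).
  have [_ _] := nf.1 i; apply; apply: divides_trans fuv.
  exact: prod_mem_divides.
have both (i : 'I_n.+1) : (i < n)%N ->
    divides (f i) (u - v) /\ divides (f i) (u + v).
  move=> /f2 fi2; have fiv : divides (f i) (2%:R * v) by exact: divides_mulr.
  have [d|d] := fi i; split=> //.
    have -> : u + v = (u - v) + 2%:R * v by ring.
    exact: dividesD.
  have -> : u - v = (u + v) - 2%:R * v by ring.
  exact: dividesB.
have ltn_max (i : 'I_n.+1) : i != ord_max -> (i < n)%N.
  by move=> ni; rewrite ltn_neqAle -ltnS ltn_ord andbT.
have [d|d] := fi ord_max; [right|left]; apply/principal_idealP;
  apply: nonassociate_primes_prod_divides => // i;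
  by have [->//|/ltn_max/both[]] := eqVneq i ord_max.
Qed.

(** Forward, the last place of the family goes to a prime divisor [p] of [a]
    that does not divide [2], when there is one; the cofactor then divides [2].
    Otherwise any prime divisor of [a] will do. *)
Lemma sdf_absorbing_principal a : a != 0 -> a \isn't a GRing.unit ->
  sdf_absorbing (principal_ideal a) <->
  exists n (f : 'I_n.+1 -> R), [/\ nonassociate_primes f,
    forall i : 'I_n.+1, (i < n)%N -> divides (f i) 2%:R &
    principal_ideal a = principal_ideal (\prod_(i < n.+1) f i)].
Proof.
move=> a0 ua; split=> [sdfa|[n [f [nf f2 ->]]]]; last exact: sdf_absorbing_prod.
have ra := sdf_absorbing_radical a0 sdfa.
have [p [m [pp aE m2]]] : exists p m, [/\ prime_element p, a = p * m &
    forall q, prime_element q -> divides q m -> divides q 2%:R].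
  have [[p [pp [m aE] np2]]|all2] := pselect (exists p,
      [/\ prime_element p, divides p a & ~ divides p 2%:R]).
    exists p, m; split=> // q _ qm; apply: divides_trans qm _.
    by move: a0 sdfa; rewrite aE => a0 /(sdf_absorbing_factor a0 pp) [].
  have [p pp [m aE]] := prime_divisor_exists R_pid a0 ua.
  exists p, m; split=> // q pq qm; apply: contrapT => nq2; apply: all2.
  by exists q; split=> //; rewrite aE; exact: divides_mull.
have [p0 pu _] := pp; rewrite {}aE in a0 ua ra sdfa *.
have m0 : m != 0 by move: a0; rewrite mulf_eq0 negb_or => /andP[].
have [n [f [nf fm]]] :=
  radical_factorization R_pid m0 (radical_element_cofactor p0 ra).
have [prodf_m _] := (associates_divides _ _).1 fm.
exists n, (insert_prime ord_max p f); split=> [|i|].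
- apply: nonassociate_primes_insert => // pf; case/negP: pu.
  by apply: (radical_element_coprime a0 ra); exact: divides_trans prodf_m.
- case: (unliftP ord_max i) => [j ->|->]; last by rewrite ltnn.
  rewrite insert_prime_lift => _; apply: m2; first exact: nf.1.
  by apply: divides_trans prodf_m; exact: prod_mem_divides.
- apply/principal_ideal_eq; rewrite prod_insert_prime.
  have [u uu ->] := fm; exists u^-1; rewrite ?unitrV //.
  by rewrite mulrCA mulKr.
Qed.

Lemma radical_principal a : a != 0 -> a \isn't a GRing.unit ->
  radical_ideal_set (principal_ideal a) <->
  exists n (f : 'I_n -> R), [/\ (1 <= n)%N, nonassociate_primes f &
    principal_ideal a = principal_ideal (\prod_(i < n) f i)].
Proof.
move=> a0 ua; split=> [/radical_ideal_setP ra|[n [f [_ nf ->]]]]; last first.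
  exact/radical_ideal_setP/radical_element_prod.
have [n [f [nf fa]]] := radical_factorization R_pid a0 ra.
exists n, f; split=> //; last by apply/esym/principal_ideal_eq.
case: n f fa {nf} => // f; rewrite big_ord0 => /associates_divides[_].
by move/divides1; rewrite (negPf ua).
Qed.

(** The prime ideals are the families of length one. *)
Lemma sdf_absorbing_prime_or a : a != 0 -> a \isn't a GRing.unit ->
  sdf_absorbing (principal_ideal a) <->
  prime_ideal_set (principal_ideal a) \/
  exists n (f : 'I_n.+1 -> R), [/\ (1 <= n)%N, nonassociate_primes f,
    forall i : 'I_n.+1, (i < n)%N -> divides (f i) 2%:R &
    principal_ideal a = principal_ideal (\prod_(i < n.+1) f i)].
Proof.
move=> a0 ua; split=> [/(sdf_absorbing_principal a0 ua)[n [f [nf f2 aE]]]|].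
  case: n f nf f2 aE => [|n] f nf f2 aE; last by right; exists n.+1, f.
  left; rewrite aE big_ord1; apply/prime_principal; last exact: nf.1.
  by case: (nf.1 ord0).
case=> [/(prime_principal a0) pa|[n [f [_ nf f2 aE]]]].
  have -> : a = \prod_(i < 1) (fun=> a) i by rewrite big_ord1.
  by apply: sdf_absorbing_prod => //; split=> // i j; rewrite !ord1.
by apply/sdf_absorbing_principal => //; exists n, f.
Qed.

(** A prime dividing the prime [2] is associate to it, so a nonassociate family
    has room for only one such prime. *)
Lemma two_prime_family a : prime_element (2%:R : R) ->
  (exists n (f : 'I_n.+1 -> R), [/\ (1 <= n)%N, nonassociate_primes f,
     forall i : 'I_n.+1, (i < n)%N -> divides (f i) 2%:R &
     principal_ideal a = principal_ideal (\prod_(i < n.+1) f i)]) <->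
  exists p, [/\ prime_element p, ~ associates p 2%:R &
     principal_ideal a = principal_ideal (2%:R * p)].
Proof.
move=> p2; split=> [[n [f [n1 nf f2 ->]]]|[p [pp np2 ->]]].
  have [f0 f0_2] : _ /\ _ := conj (nf.1 ord0) (f2 ord0 n1).
  have two_f0 := prime_divides_prime f0 p2 f0_2.
  (* If [n > 1], the primes at [0] and [1] both divide [2], so are associate. *)
  have nE : n = 1%N.
    case: n n1 f nf f2 f0 f0_2 two_f0 => [//|[//|n]] _ f nf f2 _ _ two_f0.
    have := f2 (lift ord0 ord0) isT => /divides_trans/(_ two_f0).
    by move=> /nonassociate_primes_divides; case.
  subst n; have [u uu f0E] := (associates_divides _ _).2 (conj two_f0 f0_2).
  exists (f ord_max); split; first exact: nf.1.
    move=> /associates_divides[f1_2 _].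
    have /nonassociate_primes_divides := divides_trans f1_2 two_f0.
    by case.
  apply/principal_ideal_eq; exists u^-1; rewrite ?unitrV //.
  rewrite big_ord_recr big_ord1 /= (_ : widen_ord _ _ = ord0); last exact/val_inj.
  by rewrite f0E -!mulrA mulKr.
exists 1%N, (insert_prime ord_max p (fun=> 2%:R)); split=> //.
- apply: nonassociate_primes_insert => //.
    rewrite big_ord1 => p_2; apply: np2; apply/associates_divides.
    by split=> //; exact: prime_divides_prime.
  by split=> // i j; rewrite !ord1.
- move=> i; case: (unliftP ord_max i) => [j ->|->]; last by rewrite ltnn.
  by rewrite insert_prime_lift => _; exact: divides_refl.
- by rewrite prod_insert_prime big_ord1 mulrC.
Qed.

End SdfAbsorbing.

Unset Implicit Arguments.

Theorem corollary4p3 (R : idomainType) (hR : is_pid R) (I : set R)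
    (I_proper : proper_ideal_set I) (I_nonzero : I <> [set 0]) :
  [/\ (* (a) *)
      (2%:R : R) != 0 -> (2%:R : R) \isn't a GRing.unit ->
      [/\ (sdf_absorbing I <->
           prime_ideal_set I \/
           exists (n : nat) (a : 'I_n.+1 -> R),
             [/\ (1 <= n)%N, nonassociate_primes a,
                 forall i : 'I_n.+1, (i < n)%N -> divides (a i) 2%:R &
                 I = principal_ideal (\prod_(i < n.+1) a i)]),
          (prime_ideal_set I <-> maximal_ideal_set I),
          (prime_ideal_set I <->
           exists2 a : R, prime_element a & I = principal_ideal a) &
          (prime_element (2%:R : R) ->
           (sdf_absorbing I <->
            prime_ideal_set I \/
            exists p : R, [/\ prime_element p, ~ associates p 2%:R &
                              I = principal_ideal (2%:R * p)]))],
      (* (b) *)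
      (2%:R : R) \is a GRing.unit ->
      [/\ (sdf_absorbing I <-> prime_ideal_set I),
          (prime_ideal_set I <-> maximal_ideal_set I) &
          (prime_ideal_set I <->
           exists2 a : R, prime_element a & I = principal_ideal a)] &
      (* (c) *)
      2%N \in [pchar R] ->
      (sdf_absorbing I <-> radical_ideal_set I) /\
      (radical_ideal_set I <->
       exists (n : nat) (a : 'I_n -> R),
         [/\ (1 <= n)%N, nonassociate_primes a &
             I = principal_ideal (\prod_(i < n) a i)])].
Proof.
have [a [IE a0 ua]] := proper_nonzero_principal hR I_proper I_nonzero.
have prime_max : prime_ideal_set I <-> maximal_ideal_set I.
  by rewrite IE (prime_principal a0) (maximal_principal hR a0 ua).
have prime_gen : prime_ideal_set I <->
    exists2 b : R, prime_element b & I = principal_ideal b.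
  rewrite IE; split=> [/(prime_principal a0) pa|[b pb ->]]; first by exists a.
  by apply/prime_principal => //; case: pb.
have sdfE := sdf_absorbing_prime_or hR a0 ua.
split=> [_ _|u2|char2].
- split=> // [|p2]; first by rewrite IE.
  by rewrite IE sdfE two_prime_family.
- split=> //; rewrite IE sdfE; split=> [[//|[n [f [n1 nf f2 _]]]]|]; last by left.
  have [_ /negP uf _] := nf.1 ord0.
  by case: uf; apply: divides_unit (f2 ord0 n1) u2.
- have two0 : (2%:R : R) = 0 by case/andP: char2 => _ /eqP.
  rewrite IE; split; last exact: radical_principal.
  rewrite (sdf_absorbing_principal hR a0 ua) (radical_principal hR a0 ua).
  split=> [[n [f [nf _ aE]]]|[n [f [n1 nf aE]]]]; first by exists n.+1, f.
  case: n n1 f nf aE => // n _ f nf aE.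
  by exists n, f; split=> // i _; rewrite two0; exact: divides0.
Qed.
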